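(* There is an algorithm that solves CFFA in time $O\big((2t)^{t+1}(n+m)^{O(1)}\big)$, where $n=|\mathcal{A}|$, $m=|\mathcal{I}|$, and $t=\binom{m}{2}-|E(\mathcal{H})|$.
   Context: CFFA: the input is a finite set of agents $\mathcal{A}$, a finite set of jobs $\mathcal{I}$, for each agent $a\in\mathcal{A}$ a utility function $u_a\colon\mathcal{I}\to\mathbb{N}$, a positive integer $\eta$, and a graph $\mathcal{H}$ with vertex set $\mathcal{I}$. The question is whether there is $\phi\colon\mathcal{A}\to 2^{\mathcal{I}}$ such that each $\phi(a)$ is an independent set in $\mathcal{H}$ with $\sum_{x\in\phi(a)}u_a(x)\ge\eta$, and the sets $\phi(a)$, $a\in\mathcal{A}$, are pairwise disjoint.
   Formalization: In the bound, 2t is read as max(1,2t) and n+m as max(1,n+m), since for t=0 (complete conflict graph) the printed bound is zero; for t≥1 it is unchanged, and for t=0 polynomial time is claimed; additions and subtractions of numbers count as single steps. *)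

(* Defs.v *)
From mathcomp Require Import all_boot.

Set Implicit Arguments.
Unset Strict Implicit.
Unset Printing Implicit Defensive.

Record sgraph (V : finType) := SGraph {
  adj :> rel V;
  adj_sym : symmetric adj;
  adj_irrefl : irreflexive adj
}.

Definition edge_set (V : finType) (G : sgraph V) : {set {set V}} :=
  [set [set x; y] | x in V, y in adj G x].

Definition independent (V : finType) (G : sgraph V) (S : {set V}) : Prop :=
  forall x y, x \in S -> y \in S -> ~~ adj G x y.

Record cffa := CFFA {
  agents : finType;
  jobs : finType;
  util : agents -> jobs -> nat;
  eta : nat;
  eta_gt0 : 0 < eta;
  conflict : sgraph jobs
}.

Definition is_allocation (I : cffa) (phi : agents I -> {set jobs I}) : Prop :=
  (forall a, independent (conflict I) (phi a) /\
             eta I <= \sum_(x in phi a) util a x) /\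
  (forall a b, a != b -> [disjoint phi a & phi b]).

Definition cffa_yes (I : cffa) : Prop :=
  exists phi : agents I -> {set jobs I}, is_allocation phi.

(* The subtraction never truncates: the edges are 2-subsets of the jobs. *)
Definition nonedges (I : cffa) : nat :=
  'C(#|jobs I|, 2) - #|edge_set (conflict I)|.

(* Model of computation: a unit-cost random access machine with structured
   control. Registers and array cells hold arbitrary natural numbers, the names
   of the registers and arrays are fixed in the program, and array indices are
   computed. The only arithmetic is addition and truncated subtraction:
   multiplication at unit cost would allow numbers of exponential bit length
   in polynomially many steps. *)

Inductive expr :=
  | Const of nat
  | Reg of nat
  | Get of nat & expr
  | Add of expr & expr
  | Sub of expr & expr.

(* Guards are true when they evaluate to a nonzero number. *)
Inductive prog :=
  | Skip
  | Assign of nat & expr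
  | Store of nat & expr & expr
  | Seq of prog & prog
  | If of expr & prog & prog
  | While of expr & prog.

Record state := State { reg : nat -> nat; arr : nat -> nat -> nat }.

Definition set_reg (s : state) (r v : nat) : state :=
  State (fun r' => if r' == r then v else reg s r') (arr s).

Definition set_cell (s : state) (a i v : nat) : state :=
  State (reg s)
    (fun a' i' => if (a' == a) && (i' == i) then v else arr s a' i').

Fixpoint eval (s : state) (e : expr) : nat :=
  match e with
  | Const k => k
  | Reg r => reg s r
  | Get a e1 => arr s a (eval s e1)
  | Add e1 e2 => eval s e1 + eval s e2
  | Sub e1 e2 => eval s e1 - eval s e2
  end.

Fixpoint cost (e : expr) : nat :=
  match e with
  | Const _ | Reg _ => 1
  | Get _ e1 => (cost e1).+1
  | Add e1 e2 | Sub e1 e2 => (cost e1 + cost e2).+1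
  end.

(* [exec p s k s']: started in state [s], the program [p] halts in state [s']
   after exactly [k] elementary operations. *)
Inductive exec : prog -> state -> nat -> state -> Prop :=
  | ExecSkip s : exec Skip s 1 s
  | ExecAssign s r e :
      exec (Assign r e) s (cost e).+1 (set_reg s r (eval s e))
  | ExecStore s a i e :
      exec (Store a i e) s (cost i + cost e).+1
        (set_cell s a (eval s i) (eval s e))
  | ExecSeq p q s s1 s2 k1 k2 :
      exec p s k1 s1 -> exec q s1 k2 s2 -> exec (Seq p q) s (k1 + k2) s2
  | ExecIfTrue e p q s s1 k :
      eval s e <> 0 -> exec p s k s1 -> exec (If e p q) s ((cost e).+1 + k) s1
  | ExecIfFalse e p q s s1 k :
      eval s e = 0 -> exec q s k s1 -> exec (If e p q) s ((cost e).+1 + k) s1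
  | ExecWhileTrue e p s s1 s2 k1 k2 :
      eval s e <> 0 -> exec p s k1 s1 -> exec (While e p) s1 k2 s2 ->
      exec (While e p) s ((cost e).+1 + (k1 + k2)) s2
  | ExecWhileFalse e p s :
      eval s e = 0 -> exec (While e p) s (cost e).+1 s.

Lemma exec_det p s k1 s1 k2 s2 :
  exec p s k1 s1 -> exec p s k2 s2 -> k1 = k2 /\ s1 = s2.
Proof.
move=> H; move: k2 s2; elim: p s k1 s1 / H.
- by move=> s k2 s2 H; inversion H.
- by move=> s r e k2 s2 H; inversion H.
- by move=> s a i e k2 s2 H; inversion H.
- move=> p q s s1 s2 k1 k2 _ IHp _ IHq k s' H; inversion H; subst.
  by case: (IHp _ _ H2) => ? ?; subst; case: (IHq _ _ H6) => -> ->.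
- move=> e p q s s1 k ne _ IH k2 s2 H; inversion H; subst; last by [].
  by case: (IH _ _ H7) => -> ->.
- move=> e p q s s1 k ez _ IH k2 s2 H; inversion H; subst; first by [].
  by case: (IH _ _ H7) => -> ->.
- move=> e p s s1 s2 k1 k2 ne _ IHp _ IHw k s' H; inversion H; subst; last by [].
  by case: (IHp _ _ H3) => ? ?; subst; case: (IHw _ _ H7) => -> ->.
- by move=> e p s ez k2 s2 H; inversion H.
Qed.

(* Registers 0, 1, 2 hold n, m and eta; arrays 0 and 1 hold the utility table
   and the adjacency matrix in row-major order, agents and jobs being numbered
   by [enum]. Everything else is 0. *)
Definition input (I : cffa) : state :=
  State (nth 0 [:: #|agents I|; #|jobs I|; eta I])
    (fun a => nth 0 (nth [::]
       [:: [seq util b x | b <- enum (agents I), x <- enum (jobs I)];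
           [seq nat_of_bool (adj (conflict I) x y)
              | x <- enum (jobs I), y <- enum (jobs I)]] a)).

(* The answer is read off register 0 when the program halts. No program meets a
   bound that is 0 somewhere, as (2t)^(t+1) is when the conflict graph is
   complete; such factors have to be read with base at least 1. *)
Definition solves_cffa_in_time (p : prog) (T : cffa -> nat) : Prop :=
  forall I : cffa, exists k s,
    [/\ exec p (input I) k s, k <= T I & reg s 0 <> 0 <-> cffa_yes I].

(* Main.v *)
(* A family of pairwise disjoint independent bundles extends to a partition of
   the jobs into independent sets, and such a partition is the family of fibres
   of the map [F] sending each job to the least job of its block. Every pair
   (F y, y) with F y < y is a non-edge, so [F] is determined by a subset of the
   t non-edges, and it suffices to try all 2^t <= max(1,2t)^(t+1) subsets.

   For a fixed [F], the agents have to be matched to fibres worth at least eta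
   to them. The matching is found by an auction: every fibre has a price,
   initially 0; an unmatched agent takes a cheapest fibre acceptable to him,
   evicting its owner and raising its price by 1. If all the fibres acceptable
   to some unmatched agent cost at least n, then no matching exists, so there
   are at most n m bids. *)

Require Import Defs.
From mathcomp Require Import all_boot zify.

Set Implicit Arguments.
Unset Strict Implicit.
Unset Printing Implicit Defensive.

(** * Programs with counted loops *)

(* [CFor i r c] runs [c] for [i] from 0 up to the value of register [r] on entry.
   Since these loops terminate, [run] is total, and the running time is bounded
   by the nesting depth alone. *)
Inductive cmd :=
  | CSkip
  | CAsg of nat & expr
  | CSto of nat & expr & expr
  | CSeq of cmd & cmd
  | CIf of expr & cmd & cmd
  | CFor of nat & nat & cmd.

Fixpoint compile (c : cmd) : prog :=
  match c with
  | CSkip => Skip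
  | CAsg r e => Assign r e
  | CSto a i e => Store a i e
  | CSeq c1 c2 => Seq (compile c1) (compile c2)
  | CIf e c1 c2 => If e (compile c1) (compile c2)
  | CFor i r c1 =>
      Seq (Assign i (Const 0))
          (While (Defs.Sub (Reg r) (Reg i))
                 (Seq (compile c1) (Assign i (Add (Reg i) (Const 1)))))
  end.

Fixpoint run (c : cmd) (s : state) : state :=
  match c with
  | CSkip => s
  | CAsg r e => set_reg s r (eval s e)
  | CSto a i e => set_cell s a (eval s i) (eval s e)
  | CSeq c1 c2 => run c2 (run c1 s)
  | CIf e c1 c2 => if eval s e == 0 then run c2 s else run c1 s
  | CFor i r c1 =>
      iter (reg s r) (fun s' => set_reg (run c1 s') i (reg (run c1 s') i + 1))
           (set_reg s i 0)
  end.

Fixpoint wregs (c : cmd) : seq nat :=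
  match c with
  | CSkip | CSto _ _ _ => [::]
  | CAsg r _ => [:: r]
  | CSeq c1 c2 | CIf _ c1 c2 => wregs c1 ++ wregs c2
  | CFor i _ c1 => i :: wregs c1
  end.

Fixpoint warrs (c : cmd) : seq nat :=
  match c with
  | CSkip | CAsg _ _ => [::]
  | CSto a _ _ => [:: a]
  | CSeq c1 c2 | CIf _ c1 c2 => warrs c1 ++ warrs c2
  | CFor _ _ c1 => warrs c1
  end.

Fixpoint bounds (c : cmd) : seq nat :=
  match c with
  | CSkip | CAsg _ _ | CSto _ _ _ => [::]
  | CSeq c1 c2 | CIf _ c1 c2 => bounds c1 ++ bounds c2
  | CFor _ r c1 => r :: bounds c1
  end.

(** The body of a loop writes neither the counter nor the bound, so the guard of the compiled
    [While], although evaluated anew each time, allows exactly as many rounds as the bound had on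
    entry. *)
Fixpoint wf (c : cmd) : bool :=
  match c with
  | CSkip | CAsg _ _ | CSto _ _ _ => true
  | CSeq c1 c2 | CIf _ c1 c2 => wf c1 && wf c2
  | CFor i r c1 => [&& i != r, i \notin wregs c1, r \notin wregs c1 & wf c1]
  end.

Fixpoint csize (c : cmd) : nat :=
  match c with
  | CSkip => 1
  | CAsg _ e => (cost e).+1
  | CSto _ i e => (cost i + cost e).+1
  | CSeq c1 c2 => csize c1 + csize c2
  | CIf e c1 c2 => (cost e).+1 + (csize c1 + csize c2)
  | CFor _ _ c1 => 14 + csize c1
  end.

Fixpoint depth (c : cmd) : nat :=
  match c with
  | CSkip | CAsg _ _ | CSto _ _ _ => 0
  | CSeq c1 c2 | CIf _ c1 c2 => maxn (depth c1) (depth c2)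
  | CFor _ _ c1 => (depth c1).+1
  end.

Lemma run_reg c s r : r \notin wregs c -> reg (run c s) r = reg s r.
Proof.
elim: c s => [|r' e|a i e|c1 IH1 c2 IH2|e c1 IH1 c2 IH2|i b c IH] s //=.
- by rewrite inE; case: eqP.
- by rewrite mem_cat negb_or => /andP[n1 n2]; rewrite IH2 // IH1.
- by rewrite mem_cat negb_or => /andP[n1 n2]; case: ifP; rewrite ?IH2 ?IH1.
- rewrite inE negb_or => /andP[/negPf ni n1].
  elim: (reg s b) => [|k IHk] /=; first by rewrite ni.
  by rewrite ni IH // IHk.
Qed.

Lemma run_arr c s a i : a \notin warrs c -> arr (run c s) a i = arr s a i.
Proof.
elim: c s => [|r' e|a' j e|c1 IH1 c2 IH2|e c1 IH1 c2 IH2|k b c IH] s //=.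
- by rewrite inE; case: eqP.
- by rewrite mem_cat negb_or => /andP[n1 n2]; rewrite IH2 // IH1.
- by rewrite mem_cat negb_or => /andP[n1 n2]; case: ifP; rewrite ?IH2 ?IH1.
- move=> n1; elim: (reg s b) => [|l IHl] //=.
  by rewrite IH.
Qed.

(** The frame conditions are supplied by the rule, so [P] only has to speak of what the loop
    changes. *)
Lemma run_for (P : nat -> state -> Prop) i b c s :
    wf (CFor i b c) -> P 0 (set_reg s i 0) ->
    (forall j s', j < reg s b -> reg s' i = j ->
      (forall r, r \notin wregs (CFor i b c) -> reg s' r = reg s r) ->
      (forall a x, a \notin warrs c -> arr s' a x = arr s a x) ->
      P j s' -> P j.+1 (set_reg (run c s') i j.+1)) ->
  P (reg s b) (run (CFor i b c) s).
Proof.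
move=> /and4P[ib ic bc wc] P0 PS /=.
set F := fun s' => _; set s0 := set_reg s i 0.
suff: forall k, k <= reg s b ->
    [/\ P k (iter k F s0), reg (iter k F s0) i = k,
     forall r, r \notin wregs (CFor i b c) -> reg (iter k F s0) r = reg s r
    & forall a x, a \notin warrs c -> arr (iter k F s0) a x = arr s a x].
  by move=> /(_ _ (leqnn _)) [].
elim=> [_|k IH lek] /=.
  split=> //; first by rewrite eqxx.
  by move=> r; rewrite inE negb_or => /andP[/negPf ->].
have [Pk ik fr fa] := IH (ltnW lek).
have E: F (iter k F s0) = set_reg (run c (iter k F s0)) i k.+1.
  by rewrite /F run_reg // ik addn1.
rewrite E; split.
- exact: PS.
- by rewrite /= eqxx ?run_reg ?ik ?addn1.
- move=> r rn; have := rn; rewrite inE negb_or => /andP[/negPf ri rc].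
  by rewrite /= ri run_reg // fr.
- by move=> a x an; rewrite /= run_arr // fa.
Qed.

(** A round adds 4 for the guard and 4 for the increment to the cost of the body; the initial
    assignment costs 2 and the last guard 4. The bound [T] has to hold whatever the arrays
    contain. *)
Lemma exec_for (T : nat) i b c s :
    wf (CFor i b c) ->
    (forall s', (forall r, r \notin wregs (CFor i b c) -> reg s' r = reg s r) ->
      exists2 k, exec (compile c) s' k (run c s') & k <= T) ->
  exists2 k, exec (compile (CFor i b c)) s k (run (CFor i b c) s)
           & k <= 6 + reg s b * (T + 8).
Proof.
move=> /and4P[ib ic bc wc] body /=.
pose F s' := set_reg (run c s') i (reg (run c s') i + 1).
pose W := While (Defs.Sub (Reg b) (Reg i))
  (Seq (compile c) (Assign i (Add (Reg i) (Const 1)))).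
have step: forall d s', reg s' i + d = reg s b ->
    (forall r, r \notin wregs (CFor i b c) -> reg s' r = reg s r) ->
    exists2 k, exec W s' k (iter d F s') & k <= 4 + d * (T + 8).
  have bn: b \notin wregs (CFor i b c) by rewrite inE negb_or eq_sym ib.
  elim=> [|d IH] s' id fr.
    exists 4 => //; apply: (@ExecWhileFalse (Defs.Sub (Reg b) (Reg i))).
    by rewrite /= fr // -id addn0 subnn.
  have [k1 e1 le1] := body s' fr.
  have e2 := ExecAssign (run c s') i (Add (Reg i) (Const 1)).
  have [|r rn|k2 e3 le2] := IH (F s').
  - by rewrite /F /= eqxx run_reg // -id addn1 addnS addSn.
  - have := rn; rewrite inE negb_or => /andP[/negPf ri rc].
    by rewrite /F /= ri run_reg // fr.
  exists (4 + ((k1 + 4) + k2)).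
    rewrite iterSr; apply: (@ExecWhileTrue (Defs.Sub (Reg b) (Reg i))).
    - by rewrite /= fr // -id addKn.
    - exact: (ExecSeq e1 e2).
    - exact: e3.
  by rewrite mulSn; lia.
have [|r|k e le] := step (reg s b) (set_reg s i 0).
- by rewrite /= eqxx add0n.
- by rewrite inE negb_or /= => /andP[/negPf ->].
exists (2 + k); first exact: (ExecSeq (ExecAssign s i (Const 0)) e).
by lia.
Qed.

(** No loop bound is ever written, so [D] limits the rounds of every loop, nested ones included,
    throughout the run. *)
Lemma exec_compile (D : nat) c s :
    0 < D -> wf c -> all (fun r => r \notin wregs c) (bounds c) ->
    {in bounds c, forall r, reg s r <= D} ->
  exists2 k, exec (compile c) s k (run c s) & k <= csize c * D ^ depth c.
Proof.
move=> D0; have Dx d: 0 < D ^ d by rewrite expn_gt0 D0.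
have mono x d1 d2 : d1 <= d2 -> x * D ^ d1 <= x * D ^ d2.
  by move=> le; rewrite leq_mul2l leq_pexp2l ?orbT.
elim: c s => [|r e|a i e|c1 IH1 c2 IH2|e c1 IH1 c2 IH2|i b c IH] s.
- by exists 1; [exact: ExecSkip | rewrite muln1].
- by exists (cost e).+1; [exact: ExecAssign | rewrite muln1].
- by exists (cost i + cost e).+1; [exact: ExecStore | rewrite muln1].
- move=> /andP[w1 w2] /= /allP nb le.
  have [||k1 e1 l1] := IH1 s w1.
  + apply/allP=> r rb; have := nb r; rewrite !mem_cat rb negb_or.
    by case/(_ isT)/andP.
  + by move=> r rb; apply: le; rewrite mem_cat rb.
  have [||k2 e2 l2] := IH2 (run c1 s) w2.
  + apply/allP=> r rb; have := nb r; rewrite !mem_cat rb orbT negb_or.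
    by case/(_ isT)/andP.
  + move=> r rb; rewrite run_reg; first by apply: le; rewrite mem_cat rb orbT.
    by have := nb r; rewrite !mem_cat rb orbT negb_or; case/(_ isT)/andP.
  exists (k1 + k2); first exact: ExecSeq e1 e2.
  rewrite mulnDl leq_add //.
    by apply: leq_trans l1 (mono _ _ _ _); rewrite leq_maxl.
  by apply: leq_trans l2 (mono _ _ _ _); rewrite leq_maxr.
- move=> /andP[w1 w2] /= /allP nb le.
  have le0 : (cost e).+1 <= (cost e).+1 * D ^ maxn (depth c1) (depth c2).
    by rewrite leq_pmulr.
  have [e0|/eqP ne0] := eqVneq (eval s e) 0.
    have [||k2 e2 l2] := IH2 s w2.
    + apply/allP=> r rb; have := nb r; rewrite !mem_cat rb orbT negb_or.
      by case/(_ isT)/andP.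
    + by move=> r rb; apply: le; rewrite mem_cat rb orbT.
    exists ((cost e).+1 + k2); first exact: ExecIfFalse.
    rewrite mulnDl leq_add // mulnDl (leq_trans l2) //.
    by rewrite (leq_trans (mono _ _ _ (leq_maxr (depth c1) _))) // leq_addl.
  have [||k1 e1 l1] := IH1 s w1.
  + apply/allP=> r rb; have := nb r; rewrite !mem_cat rb negb_or.
    by case/(_ isT)/andP.
  + by move=> r rb; apply: le; rewrite mem_cat rb.
  exists ((cost e).+1 + k1); first exact: ExecIfTrue.
  rewrite mulnDl leq_add // mulnDl (leq_trans l1) //.
  by rewrite (leq_trans (mono _ _ _ (leq_maxl _ (depth c2)))) // leq_addr.
- move=> w nb le; have /and4P[ib ic bc wc] := w.
  have nbP r : r \in bounds (CFor i b c) -> r \notin wregs (CFor i b c).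
    exact: (allP nb).
  have [|k ex lek] := @exec_for (csize c * D ^ depth c) i b c s w.
    move=> s' fr; apply: IH => //.
      apply/allP=> r rb; have := nbP r; rewrite !inE rb orbT negb_or.
      by case/(_ isT)/andP.
    move=> r rb; rewrite fr; first by apply: le; rewrite inE rb orbT.
    by apply: nbP; rewrite inE rb orbT.
  exists k => //; apply: leq_trans lek _.
  have lb : reg s b <= D by apply: le; rewrite inE eqxx.
  rewrite [csize _]/= [depth _]/= expnS mulnCA.
  (* As [D] is positive, the 6 can be moved inside the factor [D], where it joins the 8 to give the
     14 of [csize]. *)
  apply: leq_trans (_ : D * (6 + (csize c * D ^ depth c + 8)) <= _).
    by rewrite [D * _]mulnDr leq_add ?leq_mul // leq_pmull.
  rewrite leq_mul2l; apply/orP; right.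
  by rewrite mulnDl addnC -addnA addnC leq_add2r leq_pmulr.
Qed.

Arguments run : simpl never.

(** * Matching by auction *)

Section Auction.

Variables (n m : nat) (acc : nat -> nat -> bool).

(* [o] maps fibres to agents, so the fibres chosen for distinct agents differ. *)
Definition matched : Prop :=
  exists o : nat -> nat,
    forall b, b < n -> exists x, [/\ x < m, o x = b & acc b x].

(* [p] gives the prices; [o x] is the owner of [x] plus 1, or 0 if [x] is free. *)
Record auction (o p : nat -> nat) : Prop := Auction {
  free_price : forall x, x < m -> o x = 0 -> p x = 0;
  owned : forall x a, x < m -> o x = a.+1 ->
    [/\ a < n, acc a x & forall y, y < m -> acc a y -> p x <= (p y).+1];
  owner_inj : forall x y, x < m -> y < m -> o x = o y -> o x != 0 -> x = y;
  price_le : forall x, x < m -> p x <= n }.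

(* Let S k be the set of agents all of whose acceptable fibres cost at least k,
   and T k the set of fibres that cost at least k. A matching gives
   #|S k| <= #|T k|; the owners of T (k+1) lie in S k and differ from [a], which
   is in S k too. So #|S k| strictly decreases for k = 0, ..., n, although it is
   at most n and S n contains [a]. *)
Lemma auction_stuck o p a : auction o p -> a < n ->
    (forall x, x < m -> o x <> a.+1) ->
    (forall y, y < m -> acc a y -> n <= p y) ->
  ~ matched.
Proof.
move=> [fp ow inj _] an fr st [g gP].
pose a0 : 'I_n := Ordinal an.
pose S k := [set b : 'I_n | [forall y : 'I_m, acc b y ==> (k <= p y)]].
pose T k := [set x : 'I_m | k <= p x].
have ST k : #|S k| <= #|T k|.
  (* Values of [g] outside ['I_n] become [a0]; this is harmless, since the image only has to cover
     [S k]. *)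
  apply: leq_trans (leq_imset_card (fun x : 'I_m => insubd a0 (g x)) _).
  apply/subset_leq_card/subsetP => b; rewrite inE => /forallP bS.
  have [x [xm gx ax]] := gP b (ltn_ord b).
  apply/imsetP; exists (Ordinal xm).
    by rewrite inE; have /implyP := bS (Ordinal xm); apply.
  by apply/val_inj; rewrite val_insubd /= gx ltn_ord.
have TS k : k < n -> #|T k.+1| < #|S k|.
  move=> kn.
  (* A free fibre costs 0, so every fibre in [T k.+1] has an owner. *)
  have o0 (x : 'I_m) : x \in T k.+1 -> exists b, [/\ o x = b.+1, b < n &
      forall y, y < m -> acc b y -> p x <= (p y).+1].
    rewrite inE => px; case E: (o x) => [|b].
      by rewrite (fp _ _ E) in px.
    by have [bn _ bp] := ow _ _ (ltn_ord x) E; exists b.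
  have inS : a0 \in S k.
    rewrite inE; apply/forallP=> y; apply/implyP=> ay.
    exact: leq_trans (ltnW kn) (st _ _ ay).
  rewrite (cardsD1 a0 (S k)) inS add1n ltnS.
  pose f (x : 'I_m) : 'I_n := insubd a0 (o x).-1.
  have fE x : x \in T k.+1 -> (f x).+1 = o x.
    by case/o0=> b [ob bn _]; rewrite val_insubd ob /= bn.
  rewrite -(card_in_imset (f := f)) => [|x y xT yT fxy]; last first.
    apply/val_inj/inj; rewrite ?ltn_ord //; first by rewrite -(fE x) // -(fE y) // fxy.
    by rewrite -(fE x).
  apply/subset_leq_card/subsetP => b /imsetP[x xT ->].
  have [c [oc cn cp]] := o0 _ xT.
  have fc : f x = c :> nat by have := fE _ xT; rewrite oc => -[].
  rewrite !inE; apply/andP; split.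
    apply/eqP=> /(congr1 val) /= fa.
    by apply: (fr x) => //; rewrite -(fE _ xT) fa.
  apply/forallP=> y; apply/implyP; rewrite fc => ay.
  by rewrite -ltnS; apply: leq_trans (cp _ _ ay) => //; move: xT; rewrite inE.
have Sk k : k <= n -> #|S k| + k <= n.
  elim: k => [_|k IH kn]; first by rewrite addn0 -[X in _ <= X]card_ord max_card.
  have := IH (ltnW kn); have := leq_ltn_trans (ST k.+1) (TS k kn); lia.
have := Sk n (leqnn n); rewrite -[X in _ <= X]add0n leq_add2r leqn0 => /eqP/cards0_eq.
move/setP/(_ a0); rewrite !inE => /negP[].
by apply/forallP=> y; apply/implyP; apply: st.
Qed.

(** The bidder takes a cheapest acceptable fibre, so after the raise it pays at most 1 more than any
    other would cost. For the remaining owners this inequality survives because prices only grow. *)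
Lemma auction_bid o p a x : auction o p -> a < n ->
    (forall y, y < m -> o y <> a.+1) -> x < m -> acc a x -> p x < n ->
    (forall y, y < m -> acc a y -> p x <= p y) ->
  auction (fun i => if i == x then a.+1 else o i)
          (fun i => if i == x then p x + 1 else p i).
Proof.
move=> [fp ow inj pn] an fr xm ax px mn; split.
- by move=> y ym; case: eqP => // _; apply: fp.
- move=> y b ym; case: eqP => [->|_].
    case=> <-; split=> // z zm az; have := mn z zm az.
    by case: eqP => [->|_]; lia.
  move=> oy; have [bn ab bp] := ow _ _ ym oy; split=> // z zm az.
  by have := bp z zm az; case: eqP => [->|_]; lia.
- move=> y z ym zm; case: (eqVneq y x) (eqVneq z x) => [->|_] [->|_] //.
  + by move=> E; case: (fr z).
  + by move=> E; case: (fr y).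
  + exact: inj.
- by move=> y ym; case: eqP => [_|_]; [rewrite addn1 | exact: pn].
Qed.

Lemma auction_matched o p : auction o p ->
  (forall b, b < n -> exists2 x, x < m & o x = b.+1) -> matched.
Proof.
move=> [_ ow _ _] al; exists (fun x => (o x).-1) => b bn.
have [x xm ox] := al b bn; exists x.
by have [_ ? _] := ow _ _ xm ox; rewrite ox.
Qed.

Lemma auction0 o p : (forall x, x < m -> o x = 0 /\ p x = 0) -> auction o p.
Proof.
move=> z; split=> [x /z[]|x a /z[-> _]|x y /z[-> _]|x /z[_ ->]] //.
Qed.

End Auction.

(** * Reduction to partitions given by parent maps *)

Section Partition.

Variables (n m e : nat) (U A : nat -> nat).

Definition acceptable (F : nat -> nat) (a r : nat) : bool :=
  e <= \sum_(y < m | F y == r) U (a * m + y).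

Definition separated (F : nat -> nat) : Prop :=
  forall y z, y < m -> z < m -> F y = F z -> A (y * m + z) = 0.

Definition feasible (F : nat -> nat) : Prop :=
  separated F /\ matched n m (acceptable F).

(** Only the pairs (F y, y) are constrained, which is what makes such maps encodable by sets of
    non-edges; independence of whole fibres is left to [separated]. *)
Definition parent (F : nat -> nat) : Prop :=
  forall y, y < m -> F y <= y /\ A (F y * m + y) = 0.

Lemma feasible_ext F G : (forall y, y < m -> F y = G y) ->
  feasible F -> feasible G.
Proof.
move=> FG [sp [o oP]]; split.
  by move=> y z ym zm; rewrite -!FG //; apply: sp.
exists o => b bn; have [x [xm ox ax]] := oP b bn; exists x; split=> //.
by rewrite /acceptable -(eq_bigl _ _
  (fun y : 'I_m => congr1 (eq_op^~ x) (FG y (ltn_ord y)))).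
Qed.

End Partition.

(** * Row-major tables and the instance they describe *)

Lemma nth_allpairs (S T : Type) (f : S -> T -> nat) s t i j x0 y0 :
    i < size s -> j < size t ->
  nth 0 [seq f x y | x <- s, y <- t] (i * size t + j) =
  f (nth x0 s i) (nth y0 t j).
Proof.
move=> + jt; elim: s i => [|x s IH] [|i] //= lt.
  by rewrite nth_cat size_map jt (nth_map y0).
rewrite nth_cat size_map mulSn -addnA ltnNge leq_addr /= addKn.
exact: IH.
Qed.

Section Instance.

Variable I : cffa.

Let n := #|agents I|.
Let m := #|jobs I|.
Let U := arr (input I) 0.
Let A := arr (input I) 1.

Lemma input_util (a : agents I) (x : jobs I) :
  U (enum_rank a * m + enum_rank x) = util a x.
Proof.
have -> : m = size (enum (jobs I)) by rewrite -cardE.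
rewrite /U /= (nth_allpairs _ a x) -?cardE ?ltn_ord //.
by rewrite -!(enum_val_nth) !enum_rankK.
Qed.

Lemma input_adj (x y : jobs I) :
  A (enum_rank x * m + enum_rank y) = conflict I x y.
Proof.
have -> : m = size (enum (jobs I)) by rewrite -cardE.
rewrite /A /= (nth_allpairs _ x y) -?cardE ?ltn_ord //.
by rewrite -!(enum_val_nth) !enum_rankK.
Qed.

Lemma sum_jobs (F : nat -> nat) (a : agents I) r :
  \sum_(y < m | F y == r) U (enum_rank a * m + y) =
  \sum_(x : jobs I | F (enum_rank x) == r) util a x.
Proof.
rewrite (reindex (@enum_rank (jobs I))) /=; last first.
  by apply: onW_bij; exists enum_val; [exact: enum_rankK | exact: enum_valK].
by apply: eq_bigr => x _; rewrite input_util.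
Qed.

(** The bundle of an agent is its matched fibre. This works for any map [F], so the search may
    accept whatever a number happens to decode to. *)
Lemma feasible_yes F : feasible n m (eta I) U A F -> cffa_yes I.
Proof.
move=> [sp [o oP]].
have /fin_all_exists[g gP] (a : agents I) : exists r,
    o r = enum_rank a /\ acceptable m (eta I) U F (enum_rank a) r.
  by have [r [_ ? ?]] := oP _ (ltn_ord (enum_rank a)); exists r.
exists (fun a => [set x | F (enum_rank x) == g a]); split.
  move=> a; split.
    move=> x y; rewrite !inE => /eqP fx /eqP fy.
    by rewrite -eqb0 -input_adj; apply/eqP/sp; rewrite ?fx ?fy.
  have [_] := gP a; rewrite /acceptable sum_jobs.
  by congr (_ <= _); apply: eq_bigl => x; rewrite inE.
move=> a b ab; rewrite disjoint_subset; apply/subsetP=> x.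
rewrite !inE => /eqP ->; apply: contraNneq ab => gab.
have [oa _] := gP a; have [ob _] := gP b.
by apply/eqP/enum_rank_inj/val_inj; rewrite /= -oa -ob gab.
Qed.

Lemma yes_feasible : cffa_yes I ->
  exists2 F, parent m A F & feasible n m (eta I) U A F.
Proof.
move=> [phi [ind dis]].
pose h (x : jobs I) := [pick a | x \in phi a].
have hP x a : (h x == Some a) = (x \in phi a).
  rewrite /h; case: pickP => [b xb|/(_ a)]; last by move->.
  apply/eqP/idP=> [[<-] //|xa]; congr Some; apply/eqP.
  by apply: contraLR xa => /dis; move/disjointFr->.
pose H i := if insub i is Some j then h (@enum_val (jobs I) xpredT j) else None.
have HE x : H (enum_rank x) = h x.
  rewrite /H; case: insubP => [j _ ij|]; last by rewrite ltn_ord.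
  by rewrite (val_inj ij : j = enum_rank x) enum_rankK.
(* A job in a bundle goes to the least job of that bundle; an unallocated job forms a block of its
   own. *)
pose F y := if H y is Some a then find (fun x => H x == Some a) (iota 0 m) else y.
have hasF y : y < m -> has (fun x => H x == H y) (iota 0 m).
  by move=> ym; apply/hasP; exists y; rewrite ?mem_iota.
have FH y : y < m -> H (F y) = H y.
  move=> ym; rewrite {1}/F; case E: (H y) => [a|] //.
  have := hasF _ ym; rewrite E => hf; have := nth_find 0 hf => /eqP.
  by rewrite nth_iota //; rewrite has_find size_iota in hf.
have Fle y : y < m -> F y <= y.
  move=> ym; rewrite /F; case E: (H y) => [a|] //.
  rewrite leqNgt; apply/negP=> lt.
  have := before_find 0 lt; rewrite nth_iota // add0n.
  by rewrite E eqxx.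
have Fm y : y < m -> F y < m by move=> ym; apply: leq_ltn_trans (Fle _ ym) ym.
have inj y z : F y = F z -> H y = H z -> H y = None -> y = z.
  by rewrite /F => + E1 E2; rewrite -E1 E2.
have FS y z a : H y = Some a -> H z = Some a -> F y = F z.
  by rewrite /F => -> ->.
have rk (y : nat) : y < m -> exists x : jobs I, y = enum_rank x.
  by move=> ym; exists (enum_val (Ordinal ym)); rewrite enum_valK.
have AH y z : y < m -> z < m -> H y = H z -> (H y = None -> y = z) ->
    A (y * m + z) = 0.
  move=> ym zm; have [x ->] := rk _ ym; have [w ->] := rk _ zm.
  rewrite !HE input_adj => hxw; case E: (h x) => [a|].
    have [ia _] := ind a => _.
    by have /negPf -> : ~~ conflict I x w by apply: ia; rewrite -hP -?hxw E.
  by move/(_ erefl)/val_inj/enum_rank_inj->; rewrite adj_irrefl.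
exists F.
  move=> y ym; split; first exact: Fle.
  apply: AH => //; rewrite ?Fm ?FH // => E; rewrite /F E //.
split.
  move=> y z ym zm Fyz; have Hyz : H y = H z by rewrite -FH // Fyz FH.
  by apply: AH => // HN; apply: inj.
(* A job outside all bundles gets the owner [n], which is the number of no agent. *)
exists (fun r => if H r is Some a then nat_of_ord (enum_rank a) else n) => b bn.
pose a := enum_val (Ordinal bn : 'I_#|agents I|).
have ba : b = enum_rank a by rewrite enum_valK.
have [_ ea] := ind a.
(* Since [eta] is positive the bundle is nonempty, and any job in it leads to the fibre of the
   agent. *)
have [x xa|pa0] := pickP (mem (phi a)); last first.
  move: ea; rewrite big_pred0 //.
  by move: (eta_gt0 I); case: (eta I).
have Hx : H (enum_rank x) = Some a by rewrite HE; apply/eqP; rewrite hP.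
exists (F (enum_rank x)); split; first exact: Fm.
  by rewrite FH // Hx -ba.
rewrite /acceptable ba sum_jobs; apply: leq_trans ea _.
rewrite [X in X <= _]big_mkcond [X in _ <= X]big_mkcond /=.
apply: leq_sum => y _; case: ifP => // ya.
have Hy : H (enum_rank y) = Some a by rewrite HE; apply/eqP; rewrite hP.
by rewrite (FS _ _ _ Hy Hx) eqxx.
Qed.

(** The counted pairs inject into the 2-subsets of the jobs that are not edges. Every edge is a
    2-subset, so the number of those is the difference in [nonedges]. *)
Lemma count_nonedges :
  \sum_(y < m) \sum_(x < m) ((x < y) && (A (x * m + y) == 0)) <= nonedges I.
Proof.
pose P := [set q : 'I_m * 'I_m | (q.2 < q.1) && (A (q.2 * m + q.1) == 0)].
have -> : \sum_(y < m) \sum_(x < m) ((x < y) && (A (x * m + y) == 0)) = #|P|.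
  rewrite pair_big /= -sum1_card big_mkcond /= [RHS]big_mkcond /=.
  by apply: eq_bigr => q _; rewrite inE; case: (_ && _).
pose f (q : 'I_m * 'I_m) : {set jobs I} := [set enum_val q.1; enum_val q.2].
have card2 (G := conflict I) (B : {set jobs I}) : B \in edge_set G -> #|B| == 2.
  case/imset2P=> x y _ xy ->; have {}xy : G x y := xy; rewrite cards2.
  by case: (eqVneq x y) xy => // ->; rewrite /G adj_irrefl.
rewrite /nonedges -card_draws.
set D := [set B : {set _} | _].
have sub : edge_set (conflict I) \subset D.
  by apply/subsetP=> B /card2; rewrite inE.
rewrite -(cardsDS sub) -(card_in_imset (f := f)).
  apply/subset_leq_card/subsetP => _ /imsetP[[y x] + ->].
  rewrite !inE /= => /andP[lt nA].
  rewrite cards2 (inj_eq enum_val_inj) -[y == x]val_eqE [val y == _]gtn_eqF // andbT.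
  apply/negP => /imset2P[u v _ uv E]; have {}uv : conflict I u v := uv.
  move: nA; have := input_adj (enum_val x) (enum_val y).
  rewrite !enum_valK => ->; rewrite eqb0 => /negP; apply.
  have ir w : conflict I w w = false by apply: adj_irrefl.
  have := set21 u v; have := set22 u v; rewrite -E !inE.
  by move=> /orP[] /eqP Ev /orP[] /eqP Eu; move: uv;
    rewrite Ev Eu ?ir // adj_sym.
move=> [y x] [y' x']; rewrite !inE /= => /andP[lt _] /andP[lt' _] E.
have := set21 (enum_val y) (enum_val x); have := set22 (enum_val y) (enum_val x).
rewrite /f /= in E; rewrite E !inE !(inj_eq enum_val_inj).
(* Equality of the two sets leaves four ways to match the ends; the orders [lt] and [lt'] exclude
   all but the identity. *)
do 2![case/orP=> /eqP ?]; subst => //.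
- by rewrite ltnn in lt.
- by have := ltn_trans lt lt'; rewrite ltnn.
- by rewrite ltnn in lt.
Qed.

End Instance.

(** * The algorithm *)

Local Arguments run : simpl never.

Lemma run_asg r e s : run (CAsg r e) s = set_reg s r (eval s e).
Proof. by []. Qed.
Lemma run_sto a i e s : run (CSto a i e) s = set_cell s a (eval s i) (eval s e).
Proof. by []. Qed.
Lemma run_seq c1 c2 s : run (CSeq c1 c2) s = run c2 (run c1 s).
Proof. by []. Qed.
Lemma run_if e c1 c2 s :
  run (CIf e c1 c2) s = if eval s e == 0 then run c2 s else run c1 s.
Proof. by []. Qed.
Lemma run_skip s : run CSkip s = s.
Proof. by []. Qed.

Definition runE := (run_asg, run_sto, run_seq, run_if, run_skip).

Definition neq (e1 e2 : expr) := Add (Defs.Sub e1 e2) (Defs.Sub e2 e1).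

Lemma distn_eq0 a b : (a - b + (b - a) == 0) = (a == b).
Proof. by rewrite addn_eq0 !subn_eq0 eqn_leq. Qed.

(* Registers: 3 = n + m, 4 = bound on the number of bids, 5 = t, 6 = 2^t,
   7 = answer, 8 = current subset of the non-edges, 9 = the part of it left to
   decode, 10 = still feasible, 13 = bidding agent plus 1 (0 if none),
   14 and 15 = cheapest price and fibre found, 19 = value of a fibre,
   20 = scratch, 11, 12 and 16 to 18 = loop counters.
   Arrays: 2 = multiples of m, 3 and 4 = smaller and larger end of the i-th
   non-edge, 5 = powers of 2, 6 = F, 7 = owner plus 1 (0 if free), 8 = price. *)
Fixpoint block (cs : seq cmd) : cmd :=
  if cs is c :: cs' then if cs' is [::] then c else CSeq c (block cs') else CSkip.

(** Row offsets are tabulated by repeated addition, as the machine does not multiply; n + m rows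
    serve agents and jobs alike. Register 4 ends as (n + m) m, which plus 1 exceeds the n m possible
    bids. *)
Definition rows_cmd : cmd :=
  CFor 17 3 (block [:: CSto 2 (Reg 17) (Reg 4); CAsg 4 (Add (Reg 4) (Reg 1))]).

Definition pairs_cmd : cmd :=
  CFor 17 1 (CFor 18 1
    (CIf (Defs.Sub (Reg 17) (Reg 18))
      (CIf (Get 1 (Add (Get 2 (Reg 18)) (Reg 17))) CSkip
        (block [:: CSto 3 (Reg 5) (Reg 18); CSto 4 (Reg 5) (Reg 17);
                   CSto 5 (Reg 5) (Reg 6); CAsg 6 (Add (Reg 6) (Reg 6));
                   CAsg 5 (Add (Reg 5) (Const 1))]))
      CSkip)).

Definition init_cmd : cmd :=
  CFor 17 1 (block [:: CSto 6 (Reg 17) (Reg 17); CSto 7 (Reg 17) (Const 0);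
                       CSto 8 (Reg 17) (Const 0)]).

(** Binary digits are read from the highest down, by comparing with the tabulated powers of 2 and
    subtracting them. *)
Definition decode_cmd : cmd :=
  CFor 17 5
    (block [:: CAsg 20 (Defs.Sub (Defs.Sub (Reg 5) (Const 1)) (Reg 17));
       CIf (Defs.Sub (Get 5 (Reg 20)) (Reg 9)) CSkip
         (block [:: CAsg 9 (Defs.Sub (Reg 9) (Get 5 (Reg 20)));
                    CSto 6 (Get 4 (Reg 20)) (Get 3 (Reg 20))])]).

Definition separate_cmd : cmd :=
  CFor 17 1 (CFor 18 1
    (CIf (neq (Get 6 (Reg 17)) (Get 6 (Reg 18))) CSkip
      (CIf (Get 1 (Add (Get 2 (Reg 17)) (Reg 18))) (CAsg 10 (Const 0)) CSkip))).

Definition value_cmd : cmd :=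
  CFor 17 1
    (CIf (neq (Get 6 (Reg 17)) (Reg 16)) CSkip
      (CAsg 19 (Add (Reg 19)
        (Get 0 (Add (Get 2 (Defs.Sub (Reg 13) (Const 1))) (Reg 17)))))).

Definition scan_cmd : cmd :=
  CFor 16 1
    (block [:: CAsg 19 (Const 0); value_cmd;
       CIf (Defs.Sub (Reg 2) (Reg 19)) CSkip
         (CIf (Defs.Sub (Reg 14) (Get 8 (Reg 16)))
           (block [:: CAsg 14 (Get 8 (Reg 16)); CAsg 15 (Reg 16)]) CSkip)]).

(** The scan starts from the price [n] and accepts only strict improvements, so register 14 ends
    below [n] just when a fibre can be bought. Otherwise the bidder stays in register 13, and owners
    and prices are unchanged. *)
Definition bid_cmd : cmd :=
  block [:: CAsg 14 (Reg 0); scan_cmd;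
    CIf (Defs.Sub (Reg 0) (Reg 14))
      (block [:: CAsg 20 (Get 7 (Reg 15)); CSto 7 (Reg 15) (Reg 13);
                 CSto 8 (Reg 15) (Add (Get 8 (Reg 15)) (Const 1));
                 CAsg 13 (Reg 20)])
      CSkip].

(** A counted loop cannot stop early; once nobody bids, the remaining rounds are idle. *)
Definition auction_cmd : cmd := CFor 12 4 (CIf (Reg 13) bid_cmd CSkip).

Definition match_cmd : cmd :=
  CFor 11 0
    (block [:: CAsg 13 (Add (Reg 11) (Const 1)); auction_cmd;
               CIf (Reg 13) (CAsg 10 (Const 0)) CSkip]).

Definition try_cmd : cmd :=
  block [:: CAsg 9 (Reg 8); CAsg 10 (Const 1); init_cmd; decode_cmd;
            separate_cmd; match_cmd; CIf (Reg 10) (CAsg 7 (Const 1)) CSkip].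

Definition setup_cmd : cmd :=
  block [:: rows_cmd; CAsg 4 (Add (Reg 4) (Const 1)); CAsg 6 (Const 1); pairs_cmd].

(** * The data shared by all blocks *)

Record ctx n m e U A (s : state) : Prop := Ctx {
  ctx_n : reg s 0 = n;
  ctx_m : reg s 1 = m;
  ctx_e : reg s 2 = e;
  ctx_U : arr s 0 =1 U;
  ctx_A : arr s 1 =1 A;
  ctx_row : forall i, i < n + m -> arr s 2 i = i * m }.

Lemma ctx_frame (l1 l2 : seq nat) n m e U A s s' :
    (forall r, r \notin l1 -> reg s' r = reg s r) ->
    (forall a x, a \notin l2 -> arr s' a x = arr s a x) ->
    all (fun r => (r \notin l1) && (r \notin l2)) [:: 0; 1; 2] ->
  ctx n m e U A s -> ctx n m e U A s'.
Proof.
move=> fr fa /and4P[/andP[a0 b0] /andP[a1 b1] /andP[a2 b2] _] [<- <- <- cU cA cR].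
by split=> [|||x|x|i lt]; rewrite ?fr ?fa //; apply: cR.
Qed.

Lemma ctx_run c n m e U A s :
    all (fun r => (r \notin wregs c) && (r \notin warrs c)) [:: 0; 1; 2] ->
  ctx n m e U A s -> ctx n m e U A (run c s).
Proof. by apply: ctx_frame => [r|a x] ?; rewrite ?run_reg ?run_arr. Qed.

Lemma ctx_set r v n m e U A s :
  2 < r -> ctx n m e U A s -> ctx n m e U A (set_reg s r v).
Proof. by case: r => [|[|[|r]]] // _ [????? H]; split. Qed.

Lemma run_rows s : reg s 4 = 0 ->
  reg (run rows_cmd s) 4 = reg s 3 * reg s 1 /\
  forall i, i < reg s 3 -> arr (run rows_cmd s) 2 i = i * reg s 1.
Proof.
move=> s4; apply: (run_for (P := fun j s' => reg s' 4 = j * reg s 1 /\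
  forall i, i < j -> arr s' 2 i = i * reg s 1)) => // j s' lt s'17 fr _ [s'4 H].
rewrite /block !runE /= s'17 s'4 fr // mulSn addnC; split=> // i.
by rewrite ltnS leq_eqVlt; case: eqP => [->|_] //=; apply: H.
Qed.

Section Blocks.

Variables (n m e : nat) (U A : nat -> nat).
Local Notation ctx := (ctx n m e U A).

(** * Listing the non-edges *)

Definition is_pair x y : bool := (x < y) && (A (x * m + y) == 0).

(** [D] delimits the pairs visited so far, so that one record serves as invariant of both nested
    loops and as their result. *)
Record pairs T (D : nat -> nat -> Prop) s : Prop := Pairs {
  pairs_size : reg s 5 = T;
  pairs_pow : reg s 6 = 2 ^ T;
  pairs_weight : forall i, i < T -> arr s 5 i = 2 ^ i;
  pairs_all : forall x y, D x y -> is_pair x y ->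
    exists i, [/\ i < T, arr s 3 i = x & arr s 4 i = y] }.

Lemma run_pairs s : ctx s -> reg s 5 = 0 -> reg s 6 = 1 ->
  pairs (\sum_(y < m) \sum_(x < m) is_pair x y) (fun _ y => y < m)
    (run pairs_cmd s).
Proof.
move=> cs s5 s6; pose P j := pairs (\sum_(y < j) \sum_(x < m) is_pair x y) (fun _ y => y < j).
suff : P (reg s 1) (run pairs_cmd s) by rewrite (ctx_m cs).
apply: run_for => //.
  by split=> //; rewrite big_ord0.
move=> j s1; rewrite (ctx_m cs) => jm s17 fr fa IH; rewrite /P big_ord_recr /=.
have cs1 : ctx s1 by apply: (ctx_frame fr fa).
move: IH; rewrite /P; set S := \sum_(y < j) _ => IH.
set c := CFor _ _ _; set s2 := run c s1.
suff [a b d f] : pairs (S + \sum_(x < m) is_pair x j)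
    (fun x y => y < j \/ y = j /\ x < m) s2.
  (* A pair has [x < y], which yields [x < m] when [y = j]. *)
  split=> // x y yj xy; apply: f => //; move: xy => /andP[xy _]; lia.
pose Q k := pairs (S + \sum_(x < k) is_pair x j)
  (fun x y => y < j \/ y = j /\ x < k).
suff : Q (reg s1 1) s2 by rewrite (ctx_m cs1).
apply: run_for => //.
  by case: IH => *; split=> //=; rewrite ?big_ord0 ?addn0 // => x y [|[//]]; eauto.
move=> k s3; rewrite (ctx_m cs1) => km s318 fr3 fa3 [a b d f].
have cs3 : ctx s3 by apply: (ctx_frame fr3 fa3).
rewrite /Q big_ord_recr /= addnA; move: a b d f; set T := S + _ => a b d f.
have R : arr s3 1 (arr s3 2 (reg s3 18) + reg s3 17) = A (k * m + j).
  by rewrite s318 fr3 // s17 (ctx_row cs3) ?(ctx_A cs3) // ltn_addl.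
rewrite !runE /= R !s318 fr3 // s17 subn_eq0.
have nope : is_pair k j = false -> forall x y, y < j \/ y = j /\ x < k.+1 ->
    is_pair x y -> y < j \/ y = j /\ x < k.
  move=> E x y [|[-> xk]] xy; first by left.
  right; split=> //; move: xk; rewrite ltnS leq_eqVlt => /predU1P[xk|//].
  by rewrite xk E in xy.
case: ifP => jk.
  have E : is_pair k j = false by rewrite /is_pair ltnNge jk.
  rewrite E addn0; split=> // x y Dxy xy; apply: f => //; exact: nope.
case: eqP => [A0|/eqP/negPf A1] ; last first.
  have E : is_pair k j = false by rewrite /is_pair A1 andbF.
  rewrite E addn0; split=> // x y Dxy xy; apply: f => //; exact: nope.
have E : is_pair k j by rewrite /is_pair ltnNge jk A0.
rewrite E addn1; split=> //=; rewrite ?a ?b ?addn1 //.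
- by rewrite expnS mul2n addnn.
- by move=> i; rewrite ltnS leq_eqVlt; case: eqP => [->|_] //=; apply: d.
- move=> x y Dxy xy; have [/andP[/eqP-> /eqP->]|nx] := boolP ((x == k) && (y == j)).
    exists T.
    by rewrite ltnSn !eqxx.
  have [|//|i [iT xi yi]] := f x y.
    case: Dxy => [|[yj xk]]; first by left.
    right; split=> //; move: nx; rewrite yj eqxx andbT => nx; lia.
  by exists i; rewrite (ltn_trans iT) // !(ltn_eqF iT).
Qed.

(** * Decoding numbers into parent maps *)

Lemma run_init s y : y < reg s 1 ->
  [/\ arr (run init_cmd s) 6 y = y, arr (run init_cmd s) 7 y = 0
    & arr (run init_cmd s) 8 y = 0].
Proof.
move: y; apply: (run_for (P := fun j s' => forall y, y < j ->
  [/\ arr s' 6 y = y, arr s' 7 y = 0 & arr s' 8 y = 0])) => //.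
move=> j s' _ s'17 _ _ IH y; rewrite /block !runE /= s'17.
by rewrite ltnS leq_eqVlt; case: eqP => [->|_] //=; apply: IH.
Qed.

Definition code (s : state) (g : nat -> nat) (k : nat) : nat :=
  \sum_(i < k) (g (arr s 4 i) == arr s 3 i) * 2 ^ i.

Lemma code_lt s g k : code s g k < 2 ^ k.
Proof.
elim: k => [|k IH]; first by rewrite /code big_ord0.
rewrite /code big_ord_recr /= -/(code s g k) expnS mul2n -addnn.
by rewrite -addSn leq_add //; case: (_ == _); rewrite ?mul1n.
Qed.

(** After [j] rounds, a cell holds [g y], or still [y] provided that none of the top [j] non-edges
    is (g y, y). At the end the second case forces [g y = y], since otherwise (g y, y) would be a
    listed non-edge. *)
Lemma run_decode s T g : pairs T (fun _ y => y < m) s -> parent m A g ->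
    (forall y, y < m -> arr s 6 y = y) -> reg s 9 = code s g T ->
  forall y, y < m -> arr (run decode_cmd s) 6 y = g y.
Proof.
move=> [s5 s6 w al] pg F0 s9.
pose P j s' := reg s' 9 = code s g (T - j) /\
  forall y, y < m -> arr s' 6 y = g y \/
    arr s' 6 y = y /\
    forall i, T - j <= i < T -> arr s 4 i = y -> arr s 3 i != g y.
suff [_ H] : P T (run decode_cmd s).
  move=> y ym; have [//|[-> no]] := H y ym.
  have [gy Agy] := pg y ym.
  move: gy; rewrite leq_eqVlt => /predU1P[//|gy].
  have [|i [iT xi yi]] := al (g y) y ym; first by rewrite /is_pair gy Agy.
  by have := no i _ yi; rewrite subnn xi eqxx => /(_ iT).
suff : P (reg s 5) (run decode_cmd s) by rewrite s5.
apply: run_for => //.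
  rewrite /P subn0; split=> // y ym; right; split; first exact: F0.
  by move=> i; case: leqP.
move=> j s'; rewrite s5 => jT s17 fr fa [s'9 IH].
rewrite /P /block !runE /= s17 fr // s5 !fa //; set k := T - 1 - j.
have kT : T - j = k.+1 by lia.
have -> : T - j.+1 = k by lia.
rewrite kT /code big_ord_recr /= -/(code s g k) in s'9.
(* The lower digits sum to less than [2 ^ k], so comparing with this power reveals digit [k]. *)
have ck := code_lt s g k.
have wk : arr s 5 k = 2 ^ k by apply: w; lia.
have kk i : k <= i < T -> i = k \/ k.+1 <= i < T by lia.
rewrite s'9 wk subn_eq0; case: (eqVneq (g (arr s 4 k)) (arr s 3 k)) s'9 => gk s'9.
  rewrite mul1n leq_addl addnK; split=> //= y ym; case: eqP => [->|ny].
    by left; rewrite gk.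
  have [?|[Fy no]] := IH y ym; [by left | right; split=> // i /kk[-> ik|]].
    by case: ny; rewrite ik.
  by rewrite -kT; apply: no.
rewrite mul0n addn0 leqNgt ck /= s'9 mul0n addn0; split=> // y ym.
have [?|[Fy no]] := IH y ym; [by left | right; split=> // i /kk[-> <-|]].
  by rewrite eq_sym.
by rewrite -kT; apply: no.
Qed.

(** * Testing independence of the fibres *)

Lemma run_separate s F : ctx s -> (forall x, arr s 6 x = F x) ->
  reg (run separate_cmd s) 10 <> 0 <-> reg s 10 <> 0 /\ separated m A F.
Proof.
move=> cs sF; pose P j s' := reg s' 10 <> 0 <-> reg s 10 <> 0 /\
  forall y z, y < j -> z < m -> F y = F z -> A (y * m + z) = 0.
suff : P (reg s 1) (run separate_cmd s) by rewrite (ctx_m cs).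
apply: run_for => //; first by split=> [|[]].
move=> j s1; rewrite (ctx_m cs) => jm s17 fr fa IH.
have cs1 : ctx s1 by apply: (ctx_frame fr fa).
rewrite /P [reg _ 10]/=; set c := CFor _ _ _; set s2 := run c s1.
pose Q k s' := reg s' 10 <> 0 <-> reg s1 10 <> 0 /\
  forall z, z < k -> F j = F z -> A (j * m + z) = 0.
suff : Q m s2.
  rewrite /Q => QE; split=> [/QE[/IH[s10 H] Hj]|[s10 H]].
    split=> // y z; rewrite ltnS leq_eqVlt => /predU1P[->|yj] zm.
      exact: Hj.
    exact: H.
  apply/QE; split; last by move=> z; apply: H.
  by apply/IH; split=> // y z yj; apply: H; apply: ltnW.
suff : Q (reg s1 1) s2 by rewrite (ctx_m cs1).
apply: run_for => //; first by split=> [|[]].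
move=> k s3; rewrite (ctx_m cs1) => km s318 fr3 fa3 IH3.
have cs3 : ctx s3 by apply: (ctx_frame fr3 fa3).
have R : arr s3 1 (arr s3 2 (reg s3 17) + reg s3 18) = A (j * m + k).
  by rewrite s318 fr3 // s17 (ctx_row cs3) ?(ctx_A cs3) // ltn_addl.
rewrite !runE /= R distn_eq0 !fa3 // !fa // !sF s318 fr3 // s17.
have keep : (F j = F k -> A (j * m + k) = 0) -> Q k.+1 s3.
  move=> E; split=> [/IH3[s10 H]|[s10 H]].
    split=> // z; rewrite ltnS leq_eqVlt => /predU1P[->|] //; exact: H.
  by apply/IH3; split=> // z zk; apply: H; apply: ltnW.
case: eqP => Fjk; last exact: keep.
case: eqP => Ajk; first exact: keep.
by split=> //= -[_ /(_ k (ltnSn k) Fjk)].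
Qed.

(** * Execution of the auction for a fixed map *)

Section Matching.

Variable F : nat -> nat.
Let acc := acceptable m e U F.

Lemma run_value s a : ctx s -> (forall x, arr s 6 x = F x) ->
    reg s 13 = a.+1 -> a < n -> reg s 19 = 0 ->
  reg (run value_cmd s) 19 = \sum_(y < m | F y == reg s 16) U (a * m + y).
Proof.
move=> cs sF s13 an s19.
pose P j s' := reg s' 19 = \sum_(y < j | F y == reg s 16) U (a * m + y).
suff : P (reg s 1) (run value_cmd s) by rewrite (ctx_m cs).
apply: run_for => //; first by rewrite /P /= big_ord0.
move=> j s'; rewrite (ctx_m cs) => jm s17 fr fa IH.
have cs' : ctx s' by apply: (ctx_frame fr fa).
rewrite !runE /= distn_eq0 fa // s17 [reg s' 13]fr // [reg s' 16]fr // s13 subn1 /= sF.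
rewrite /P big_mkcond big_ord_recr /= -big_mkcond /= -IH.
case: (_ == _); last by rewrite addn0.
by rewrite /= (ctx_U cs') (ctx_row cs') // ltn_addr.
Qed.

(** Register 15 is meaningful only once register 14 has dropped below its initial value [n]. *)
Lemma run_scan s a : ctx s -> (forall x, arr s 6 x = F x) ->
    reg s 13 = a.+1 -> a < n -> reg s 14 = n ->
  let s' := run scan_cmd s in
  (reg s' 14 < n -> [/\ reg s' 15 < m, acc a (reg s' 15)
                     & arr s 8 (reg s' 15) = reg s' 14]) /\
  (forall x, x < m -> acc a x -> reg s' 14 <= arr s 8 x).
Proof.
move=> cs sF s13 an s14 /=.
pose P j s' :=
  (reg s' 14 < n -> [/\ reg s' 15 < m, acc a (reg s' 15)
                     & arr s 8 (reg s' 15) = reg s' 14]) /\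
  (forall x, x < j -> acc a x -> reg s' 14 <= arr s 8 x).
suff : P (reg s 1) (run scan_cmd s) by rewrite (ctx_m cs).
apply: run_for => //; first by split=> //=; rewrite s14 ltnn.
move=> j s1; rewrite (ctx_m cs) => jm s116 fr fa [IH1 IH2].
have cs1 : ctx s1 by apply: (ctx_frame fr fa).
rewrite /block run_seq run_asg run_seq.
set s2 := set_reg s1 _ _; set s3 := run value_cmd s2.
have cs2 : ctx s2 by apply: ctx_set.
have cs3 : ctx s3 by apply: ctx_run.
have s319 : (e <= reg s3 19) = acc a j.
  rewrite /s3 (run_value (a := a)) //= ?s116 // ?fr //.
  by move=> x; rewrite /= fa.
have [r14 r15 r16] : [/\ reg s3 14 = reg s1 14, reg s3 15 = reg s1 15
                      & reg s3 16 = j] by rewrite /s3 !run_reg.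
have a8 x : arr s3 8 x = arr s 8 x by rewrite /s3 run_arr //= fa.
rewrite run_if /= (ctx_e cs3) subn_eq0 s319.
have keep : (acc a j -> reg s1 14 <= arr s 8 j) -> P j.+1 (set_reg s3 16 j.+1).
  move=> H; split=> /=; rewrite r14 ?r15 // => x.
  by rewrite ltnS leq_eqVlt => /predU1P[->|] //; apply: IH2.
case: ifP => aj; last by rewrite run_skip; apply: keep; rewrite aj.
rewrite run_if /= subn_eq0 r14 r16 a8; case: leqP => [le|lt].
  by rewrite run_skip; apply: keep.
rewrite !runE; split=> /=; rewrite !a8 r16.
  by [].
move=> x; rewrite ltnS leq_eqVlt => /predU1P[->|xj ax] //.
by apply: leq_trans (ltnW lt) (IH2 x xj ax).
Qed.

(* [c] is the bidder plus 1, or 0 if there is none; the agents up to [a] have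
   entered the auction, and under the flag [k] none of them has failed before. *)
Record arena (k : bool) a (o p : nat -> nat) c : Prop := Arena {
  arena_auction : auction n m acc o p;
  arena_le : forall x, x < m -> o x <= a.+1;
  arena_cur : c <= a.+1;
  arena_free : c != 0 -> forall x, x < m -> o x <> c;
  arena_all : k -> forall b, b <= a -> c <> b.+1 ->
    exists2 x, x < m & o x = b.+1 }.

Lemma arena_ext k a o p o' p' c : o =1 o' -> p =1 p' ->
  arena k a o p c -> arena k a o' p' c.
Proof.
move=> oo pp [[a1 a2 a3 a4] b1 b2 b3 b4]; split=> //.
- split.
  + by move=> x xm; rewrite -oo -pp; apply: a1.
  + move=> x b xm; rewrite -oo -pp => /(a2 _ _ xm)[bn ab bp].
    by split=> // y ym /(bp y ym); rewrite -pp.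
  + by move=> x y xm ym; rewrite -!oo; apply: a3.
  + by move=> x xm; rewrite -pp; apply: a4.
- by move=> x xm; rewrite -oo; apply: b1.
- by move=> c0 x xm; rewrite -oo; apply: b3.
- by move=> kt b ba cb; have [x xm ox] := b4 kt b ba cb; exists x; rewrite -?oo.
Qed.

(** The evicted owner becomes the next bidder, and [o x] is 0 if the fibre was free, so no agent
    gets lost. *)
Lemma arena_bid k a o p c x : arena k a o p c.+1 -> a < n -> x < m ->
    acc c x -> p x < n -> (forall y, y < m -> acc c y -> p x <= p y) ->
  arena k a (fun i => if i == x then c.+1 else o i)
            (fun i => if i == x then p x + 1 else p i) (o x).
Proof.
move=> [au le cu fr al] an xm ax px mn; split.
- by apply: auction_bid => //; [apply: leq_trans an; rewrite ltnS in cu |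
    exact: fr].
- by move=> y ym; case: eqP => // _; apply: le.
- exact: le.
- move=> ox y ym; case: eqP => [_|yx]; first by move=> E; case: (fr isT x).
  by move=> oyx; case: yx; apply: (owner_inj au) => //; rewrite oyx.
- move=> kt b ba ob; case: (eqVneq c b) => [->|cb].
    by exists x; rewrite ?eqxx.
  have [|y ym oy] := al kt b ba; first by case=> /eqP; rewrite (negPf cb).
  by exists y => //; case: eqP => // yx; case: ob; rewrite -yx.
Qed.

(** The sum of the prices measures progress: a purchase raises it by 1, and when nothing can be
    bought [auction_stuck] applies. *)
Lemma run_bid k a s c : ctx s -> (forall x, arr s 6 x = F x) ->
    reg s 13 = c.+1 -> a < n -> arena k a (arr s 7) (arr s 8) c.+1 ->
  let s' := run bid_cmd s in
  arena k a (arr s' 7) (arr s' 8) (reg s' 13) /\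
  (\sum_(x < m) arr s' 8 x = (\sum_(x < m) arr s 8 x).+1 \/
   ~ matched n m acc).
Proof.
move=> cs sF s13 an ar /=; have cn : c < n.
  by apply: leq_trans an; case: ar => _ _; rewrite ltnS.
rewrite /bid_cmd /block run_seq run_asg run_seq.
set s1 := set_reg s _ _; set s2 := run scan_cmd s1.
have cs1 : ctx s1 by apply: ctx_set.
have cs2 : ctx s2 by apply: ctx_run.
have [H1 H2] := @run_scan s1 c cs1 sF s13 cn (ctx_n cs).
rewrite -/s2 in H1 H2.
have a7 x : arr s 7 x = arr s2 7 x by rewrite /s2 run_arr.
have a8 x : arr s 8 x = arr s2 8 x by rewrite /s2 run_arr.
have r13 : reg s2 13 = c.+1 by rewrite /s2 run_reg.
have := arena_ext a7 a8 ar => {}ar.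
rewrite run_if /= (ctx_n cs2) subn_eq0; case: leqP => [le|lt].
  rewrite run_skip r13; split=> //; right.
  apply: (auction_stuck (arena_auction ar) cn); first exact: (arena_free ar).
  by move=> y ym ay; rewrite -a8; apply: leq_trans le (H2 y ym ay).
have [xm ax px] := H1 lt.
rewrite !runE /=; split.
  rewrite r13; apply: arena_bid => //; rewrite -a8 px // => y ym.
  by rewrite -a8; apply: H2.
left; rewrite (bigD1 (Ordinal xm)) //= eqxx [in RHS](bigD1 (Ordinal xm)) //=.
rewrite addn1 -a8 addSn; congr (_ + _).+1; apply: eq_bigr => y.
by rewrite -val_eqE /= => /negPf->.
Qed.

(** If somebody still bids after [j] rounds, then the prices sum to at least [j] or no matching
    exists. The sum is at most n m, and there are more rounds than that. *)
Lemma run_auction k a s : ctx s -> (forall x, arr s 6 x = F x) ->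
    n * m < reg s 4 -> a < n -> arena k a (arr s 7) (arr s 8) (reg s 13) ->
  let s' := run auction_cmd s in
  arena k a (arr s' 7) (arr s' 8) (reg s' 13) /\
  (reg s' 13 <> 0 -> ~ matched n m acc).
Proof.
move=> cs sF L an ar /=.
pose P j s' := arena k a (arr s' 7) (arr s' 8) (reg s' 13) /\
  (reg s' 13 <> 0 -> j <= \sum_(x < m) arr s' 8 x \/ ~ matched n m acc).
suff [ar' H] : P (reg s 4) (run auction_cmd s).
  split=> // /H[le|//]; have : \sum_(x < m) arr (run auction_cmd s) 8 x <= n * m.
    rewrite -[m in n * m]card_ord mulnC -sum_nat_const; apply: leq_sum => x _.
    by apply: price_le (arena_auction ar') _ (ltn_ord x).
  by lia.
apply: run_for => //; first by split=> //= _; left.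
move=> j s' _ s'12 fr fa [IH1 IH2].
have cs' : ctx s' by apply: (ctx_frame fr fa).
rewrite run_if run_skip /=; case: eqP => [c0|]; first by split=> //= /(_ c0).
case E: (reg s' 13) => [//|c] _.
rewrite E in IH1 IH2; have sF' x : arr s' 6 x = F x by rewrite fa.
have [ar'' H] := run_bid cs' sF' E an IH1.
split=> //= _; case: H => [->|]; last by right.
by have [//|?|?] := IH2; [left | right].
Qed.

Lemma run_match s : ctx s -> (forall x, arr s 6 x = F x) -> n * m < reg s 4 ->
    (forall x, x < m -> arr s 7 x = 0 /\ arr s 8 x = 0) ->
  reg (run match_cmd s) 10 <> 0 <-> reg s 10 <> 0 /\ matched n m acc.
Proof.
move=> cs sF L z.
pose P a s' := [/\ auction n m acc (arr s' 7) (arr s' 8),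
  forall x, x < m -> arr s' 7 x <= a,
  reg s' 10 <> 0 -> reg s 10 <> 0 /\
    forall b, b < a -> exists2 x, x < m & arr s' 7 x = b.+1 &
  reg s' 10 = 0 -> reg s 10 = 0 \/ ~ matched n m acc].
suff [au _ H1 H2] : P n (run match_cmd s).
  split=> [/H1[s10 al]|[s10 ma] E]; last by case: (H2 E).
  by split=> //; apply: auction_matched au _.
suff : P (reg s 0) (run match_cmd s) by rewrite (ctx_n cs).
apply: run_for => //.
  split=> //=; first exact: auction0.
  - by move=> x /z[->].
  - by left.
move=> a s1; rewrite (ctx_n cs) => an s111 fr fa [au le H1 H2].
have cs1 : ctx s1 by apply: (ctx_frame fr fa).
rewrite /block run_seq run_asg run_seq.
set s2 := set_reg s1 _ _; set s3 := run auction_cmd s2.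
have cs2 : ctx s2 by apply: ctx_set.
have sF2 x : arr s2 6 x = F x by rewrite /= fa.
have L2 : n * m < reg s2 4 by rewrite /= fr.
(* After a failure the flag is down and [arena_all] claims nothing, while the auction goes on with
   the later agents. *)
have [|ar H] := run_auction (k := reg s1 10 != 0) cs2 sF2 L2 an.
  rewrite /= s111 addn1; split=> //.
  + by move=> x /le /leqW.
  + by move=> _ x /le /[swap] ->; rewrite ltnn.
  + move=> /eqP /H1[_ al] b; rewrite leq_eqVlt => /predU1P[->//|ba] _.
    exact: al.
rewrite -/s3 in ar H.
have r10 : reg s3 10 = reg s1 10 by rewrite /s3 run_reg.
rewrite run_if /=; case: eqP => c0.
  rewrite run_skip; split=> /=; rewrite ?r10 //.
  - exact: arena_auction ar.
  - exact: arena_le ar.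
  - move=> ok; split; first by case: (H1 ok).
    by move=> b ba; apply: (arena_all ar) => //; [apply/eqP | rewrite c0].
rewrite run_asg; split=> //=.
- exact: arena_auction ar.
- exact: arena_le ar.
- by move=> _; right; apply: H.
Qed.

End Matching.

(** * Search over all subsets of the non-edges *)

Lemma run_try s T : ctx s -> pairs T (fun _ y => y < m) s ->
    n * m < reg s 4 ->
  exists F,
    (forall g, parent m A g -> reg s 8 = code s g T ->
       forall y, y < m -> F y = g y) /\
    (reg (run try_cmd s) 7 <> 0 <-> reg s 7 <> 0 \/ feasible n m e U A F).
Proof.
move=> cs ps L; rewrite /try_cmd /block !run_seq !run_asg.
set s2 := set_reg _ 10 _.
have cs2 : ctx s2 by do 2!apply: ctx_set => //.
set s3 := run init_cmd s2; have cs3 : ctx s3 by apply: ctx_run.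
have init y : y < m -> [/\ arr s3 6 y = y, arr s3 7 y = 0 & arr s3 8 y = 0].
  by rewrite -(ctx_m cs2); apply: run_init.
have ps3 : pairs T (fun _ y => y < m) s3.
  case: ps => a b c d; split; rewrite ?run_reg //.
    by move=> i /c; rewrite run_arr.
  move=> x y Dy xy; have [i [iT xi yi]] := d x y Dy xy.
  by exists i; rewrite !run_arr.
set s4 := run decode_cmd s3; have cs4 : ctx s4 by apply: ctx_run.
set s5 := run separate_cmd s4; have cs5 : ctx s5 by apply: ctx_run.
set s6 := run match_cmd s5.
(* The map under test is the decoded array; its values are known only when register 8 is the code of
   a parent map. *)
exists (arr s4 6); split.
  move=> g pg cg; apply: (run_decode ps3 pg).
    by move=> y /init[].
  rewrite run_reg //= cg; apply: eq_bigr => i _.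
  by rewrite !run_arr.
have S := run_separate cs4 (fun x => erefl).
have [||x xm|M1 M2] := @run_match (arr s4 6) s5 cs5.
- by move=> x; rewrite run_arr.
- by rewrite !run_reg.
- by rewrite !(@run_arr separate_cmd, @run_arr decode_cmd) //; case: (init x xm).
rewrite -/s5 -/s6 in S M1 M2.
have s410 : reg s4 10 <> 0 by rewrite !run_reg.
have s67 : reg s6 7 = reg s 7 by rewrite !run_reg.
rewrite !runE /=; case: eqP => ok; rewrite ?s67 /=.
  split=> [|[|[sp ma]]] //; first by left.
  by case: (M2 (conj (proj2 S (conj s410 sp)) ma)).
split=> // _; right; have [/S[_ sp] ma] := M1 ok.
by split.
Qed.

Definition search_cmd : cmd := CFor 8 6 try_cmd.

(** A feasible parent map is met in the round numbered by its code, which is below [2 ^ T] by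
    [code_lt]. *)
Lemma run_search s T : ctx s -> pairs T (fun _ y => y < m) s ->
    n * m < reg s 4 -> reg s 7 = 0 ->
  let s' := run search_cmd s in
  (reg s' 7 <> 0 -> exists F, feasible n m e U A F) /\
  (forall F, parent m A F -> feasible n m e U A F -> reg s' 7 <> 0).
Proof.
move=> cs ps L s7 /=.
pose P c s' := (reg s' 7 <> 0 -> exists F, feasible n m e U A F) /\
  (forall F, parent m A F -> feasible n m e U A F -> code s F T < c ->
     reg s' 7 <> 0).
suff [H1 H2] : P (reg s 6) (run search_cmd s).
  split=> // F pF fF; apply: H2 pF fF _.
  by rewrite (pairs_pow ps) code_lt.
apply: run_for => // c s' _ s'8 fr fa [IH1 IH2].
have cs' : ctx s' by apply: (ctx_frame fr fa).
have ps' : pairs T (fun _ y => y < m) s'.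
  case: ps => a b w d; split; rewrite ?fr //.
    by move=> i /w; rewrite fa.
  move=> x y Dy xy; have [i [iT xi yi]] := d x y Dy xy.
  by exists i; rewrite !fa.
have [|F [FE R]] := run_try cs' ps'; first by rewrite fr.
split=> /=; first by case/R => [/IH1|fF] //; exists F.
move=> g pg fg; rewrite ltnS leq_eqVlt => /predU1P[cg|cg]; apply/R; last first.
  by left; apply: IH2 cg.
right; apply: feasible_ext fg => y ym; rewrite (FE g pg) //.
by rewrite s'8 -cg; apply: eq_bigr => i _; rewrite !fa.
Qed.

End Blocks.

(** * Setup, running time and conclusion *)

Lemma setup_spec n m e U A s :
    reg s 0 = n -> reg s 1 = m -> reg s 2 = e -> reg s 3 = n + m ->
    reg s 4 = 0 -> reg s 5 = 0 -> arr s 0 =1 U -> arr s 1 =1 A ->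
  let s' := run setup_cmd s in
  [/\ ctx n m e U A s', reg s' 4 = ((n + m) * m).+1 &
    pairs m A (\sum_(y < m) \sum_(x < m) is_pair m A x y) (fun _ y => y < m) s'].
Proof.
move=> s0 s1 s2 s3 s4 s5 sU sA /=.
have [] := run_rows s4; rewrite s3 s1 => r4 row.
rewrite /setup_cmd /block !run_seq !run_asg.
set t0 := run rows_cmd s in r4 row *.
have c0 : ctx n m e U A t0.
  by split=> [|||x|x|//]; rewrite ?run_reg ?run_arr.
set t := set_reg _ 6 _.
have ct : ctx n m e U A t by do 2!apply: ctx_set => //.
split; first exact: ctx_run.
  by rewrite run_reg //= r4 addn1.
apply: (run_pairs ct) => //.
by rewrite /t /= /t0 run_reg.
Qed.

Lemma two_pow_le t : 2 ^ t <= maxn 1 (2 * t) ^ t.+1.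
Proof.
case: t => [|t]; first by [].
apply: leq_trans (_ : maxn 1 (2 * t.+1) ^ t.+1 <= _).
  by rewrite leq_exp2r // leq_max leq_pmulr ?orbT.
by rewrite leq_pexp2l // leq_max.
Qed.

Definition cffa_cmd : cmd :=
  block [:: CAsg 3 (Add (Reg 0) (Reg 1)); setup_cmd; search_cmd; CAsg 0 (Reg 7)].

Theorem theorem7 :
  exists (p : prog) (C c : nat),
    solves_cffa_in_time p
      (fun I : cffa =>
         C * (maxn 1 (2 * nonedges I) ^ (nonedges I).+1 *
              maxn 1 (#|agents I| + #|jobs I|) ^ c)).
Proof.
(* With loops nested at most 4 deep in a trial and bounds of at most [D], the polynomial part is
   [D ^ 4], that is 16 times [X ^ 8]. The 20 collects the constants 4, 2, 6 and 8 of the assignments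
   and of the search loop. *)
exists (compile cffa_cmd), ((csize setup_cmd + csize try_cmd + 20) * 16), 8 => I.
set n := #|agents I|; set m := #|jobs I|.
pose s1 := run (CAsg 3 (Add (Reg 0) (Reg 1))) (input I).
pose s2 := run setup_cmd s1; pose s3 := run search_cmd s2.
(* The factor 2 absorbs the 1 in the bound (n + m) m + 1 on the rounds of the auction. *)
pose X := maxn 1 (n + m); pose D := 2 * X ^ 2.
have X0 : 0 < X by rewrite leq_max.
have nmX : n + m <= X by rewrite leq_maxr.
have XD : X <= D by rewrite /D; nia.
have D0 : 0 < D by apply: leq_trans XD.
have [cs2 s24 ps2] := @setup_spec n m (eta I) _ _ s1 erefl erefl erefl erefl
  erefl erefl (fun x => erefl) (fun x => erefl).
rewrite -/s2 in cs2 s24 ps2.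
set T := \sum_(y < m) _ in ps2.
have Tt : T <= nonedges I by apply: count_nonedges.
have TD : T <= D.
  apply: leq_trans (_ : \sum_(y < m) \sum_(x < m) 1 <= _).
    by apply: leq_sum => y _; apply: leq_sum => x _; case: is_pair.
  by rewrite !sum_nat_const !card_ord /D; nia.
have [k2 e2 le2] : exists2 k, exec (compile setup_cmd) s1 k s2 &
    k <= csize setup_cmd * D ^ depth setup_cmd.
  apply: exec_compile => // r; rewrite !inE.
  by case/or3P=> /eqP-> /=; apply: leq_trans XD; apply: leq_trans nmX;
    rewrite ?leq_addl.
(* The search loop is timed on its own: its bound [2 ^ T] is exponential and must enter once, not
   through [D]. *)
have [k3 e3 le3] : exists2 k, exec (compile search_cmd) s2 k s3 &
    k <= 6 + reg s2 6 * (csize try_cmd * D ^ depth try_cmd + 8).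
  apply: exec_for => // s' fr; apply: exec_compile => // r rb.
  have nm : n * m < reg s2 4 by rewrite s24; nia.
  rewrite fr; last by move: r rb; apply/allP.
  have /allP/(_ r rb) : all (fun r => r \in [:: 0; 1; 4; 5]) (bounds try_cmd) by [].
  rewrite !inE => /or4P[] /eqP->.
  - by rewrite (ctx_n cs2); lia.
  - by rewrite (ctx_m cs2); lia.
  - by rewrite s24 /D; nia.
  - by rewrite (pairs_size ps2).
have ex : exec (compile cffa_cmd) (input I) (4 + (k2 + (k3 + 2)))
    (set_reg s3 0 (reg s3 7)).
  apply: ExecSeq (ExecAssign _ _ _) _; apply: ExecSeq e2 _; apply: ExecSeq e3 _.
  exact: (ExecAssign s3 0 (Reg 7)).
exists (4 + (k2 + (k3 + 2))), (set_reg s3 0 (reg s3 7)); split=> //.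
  rewrite (pairs_pow ps2) in le3.
  set Y := maxn 1 (2 * _) ^ _.
  have TY : 2 ^ T <= Y.
    by apply: leq_trans (two_pow_le _); rewrite leq_exp2l.
  have Y1 : 0 < Y by rewrite (leq_trans _ TY) ?expn_gt0.
  have D4 : D ^ 4 = 16 * X ^ 8 by rewrite /D expnMn -expnM.
  have D2 : D ^ 2 <= D ^ 4 by rewrite leq_pexp2l.
  have -> : (csize setup_cmd + csize try_cmd + 20) * 16 * (Y * X ^ 8) =
      (csize setup_cmd + csize try_cmd + 20) * (Y * D ^ 4) by rewrite D4; lia.
  move: le2 le3 D2; rewrite -[depth setup_cmd]/2 -[depth try_cmd]/4.
  have : 0 < D ^ 4 by rewrite expn_gt0 D0.
  move: (D ^ 4) (D ^ 2) (csize _) (csize _) => d d2 b a d0 le2 le3 dd.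
  have : d <= Y * d by rewrite leq_pmull.
  have : a * d2 <= a * (Y * d) by rewrite leq_mul2l (leq_trans dd) ?orbT ?leq_pmull.
  have : 2 ^ T * (b * d + 8) <= Y * (b * d + 8) by rewrite leq_mul2r TY orbT.
  have : Y * 8 <= Y * d * 8 by rewrite leq_mul2r leq_pmulr.
  lia.
have nm : n * m < reg s2 4 by rewrite s24; nia.
have [|H1 H2] := run_search cs2 ps2 nm; first by rewrite run_reg.
split=> /= [/H1[F]|/yes_feasible[F pF fF]]; first exact: feasible_yes.
exact: H2 pF fF.
Qed.
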